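(* Let $k$ be a field and let $A$ be an associative $k$-algebra that is a PI-algebra satisfying a polynomial identity of degree $d$. For $n \geq d$ let $K_n = \frac{n-d}{2}$. Then for every $n \geq d$ we have $$c_n(A) \leq \#\widehat{B}(K_n),$$ where $c_n(A)$ is the $n$-th codimension of $A$ and $\widehat{B}(K_n) = \{\sigma \in S_n \mid |\sigma| \geq K_n\}$.
   Context: Let $k\langle X\rangle = k\langle x_1, x_2, \dots\rangle$ be the free associative $k$-algebra on countably many variables. An associative $k$-algebra $A$ is a PI-algebra if it satisfies a polynomial identity, i.e. there is a nonzero $f = f(x_1,\dots,x_m) \in k\langle X\rangle$ with $f(a_1,\dots,a_m) = 0$ for all $a_i \in A$; the degree of the identity is the degree of $f$. $\mathrm{Id}(A) \subset k\langle X\rangle$ denotes the ideal of all polynomial identities of $A$. Let $P_n = \mathrm{span}_k\{x_{\sigma(1)}\cdots x_{\sigma(n)} \mid \sigma \in S_n\}$ be the space of multilinear polynomials of degree $n$ in $x_1,\dots,x_n$. The $n$-th codimension of $A$ is $c_n(A) = \dim_k \frac{P_n}{P_n \cap \mathrm{Id}(A)}$. For $\sigma \in S_n$, $|\sigma|$ denotes the word length of $\sigma$ with respect to the generating set of adjacent transpositions $t_i = (i,i+1)$, $1 \leq i \leq n-1$; equivalently $|\sigma| = \#R_\sigma$ with $R_\sigma = \{(i,j) \mid 1\leq i<j\leq n,\ \sigma(j)<\sigma(i)\}$ the set of inversions. $\#$ denotes cardinality. *)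

(* Defs.v *)
From HB Require Import structures.
From mathcomp Require Import all_boot all_order all_algebra all_fingroup.
From mathcomp Require Import finmap monalg.
From mathcomp Require Import boolp classical_sets.

Set Implicit Arguments.
Unset Strict Implicit.
Unset Printing Implicit Defensive.

Import Order.TTheory GRing.Theory Num.Theory.
Local Open Scope ring_scope.

(* Associative algebras are not required to be unital; the unital ones
   ([algType k]) are covered through [unital_assocAlgebra]. *)
Record assocAlgebra (k : fieldType) := AssocAlgebra {
  acarrier :> lmodType k;
  amul : acarrier -> acarrier -> acarrier;
  amulA : associative amul;
  amulDl : left_distributive amul +%R;
  amulDr : right_distributive amul +%R;
  amulZl : forall (c : k) x y, amul (c *: x) y = c *: amul x y;
  amulZr : forall (c : k) x y, amul x (c *: y) = c *: amul x y
}.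

Definition unital_assocAlgebra (k : fieldType) (A : algType k) :
    assocAlgebra k :=
  @AssocAlgebra k A *%R (@mulrA A) (@mulrDl A) (@mulrDr A)
    (fun c x y => esym (scalerAl c x y)) (fun c x y => esym (scalerAr c x y)).

(* k<X>, with variables x_0, x_1, ... *)
Notation freeAlg k := {malg k[{fmonom nat}]}.

Section FreeAlgebra.
Variable k : fieldType.

Definition fvar (i : nat) : freeAlg k := << fmu i >>.

(* The degree of a nonzero element (and 0 on 0). *)
Definition fpdeg (f : freeAlg k) : nat := \max_(w <- msupp f) fdeg w.

Variable A : assocAlgebra k.

(* The value of a word of length at least 1; the value 0 on the empty word is
   never used, see [is_identity]. *)
Definition weval (a : nat -> A) (w : seq nat) : A :=
  if w is i :: w' then foldl (@amul k A) (a i) (map a w') else 0.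

Definition feval (a : nat -> A) (f : freeAlg k) : A :=
  \sum_(w <- msupp f) f@_w *: weval a w.

(* As A need not have a unit, only elements of k<X> without constant term can
   be evaluated in A.  Nothing is lost for unital A <> 0: f(0) = 0 forces the
   constant term of f to vanish. *)
Definition is_identity (f : freeAlg k) : Prop :=
  f@_(@mone {fmonom nat}) = 0 /\ forall a : nat -> A, feval a f = 0.

Definition satisfies_PI_of_degree (d : nat) : Prop :=
  exists f : freeAlg k, [/\ f != 0, is_identity f & fpdeg f = d].

End FreeAlgebra.

(* [e] induces a basis of the vector space V / W, for subspaces W <= V. *)
Definition quot_basis (k : fieldType) (E : lmodType k) (V W : set E)
    (m : nat) (e : 'I_m -> E) : Prop :=
  (forall i, V (e i)) /\
  (forall v, V v -> exists! c : 'rV[k]_m, W (v - \sum_i c 0 i *: e i)).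

Definition is_quot_dim (k : fieldType) (E : lmodType k) (V W : set E)
    (m : nat) : Prop :=
  exists e : 'I_m -> E, quot_basis V W e.

Section QuotDim.
Variables (k : fieldType) (E : lmodType k) (V W : set E).
Hypothesis W0 : W 0.
Hypothesis WP : forall (c : k) u v, W u -> W v -> W (c *: u + v).

Let WZ c u : W u -> W (c *: u).
Proof. by move=> Wu; rewrite -[_ *: _]addr0; apply: WP. Qed.

Let WB u v : W u -> W v -> W (u - v).
Proof. by move=> Wu Wv; rewrite addrC -scaleN1r; apply: WP. Qed.

Lemma is_quot_dim_ex (N : nat) (s : 'I_N -> E) :
    (forall i, V (s i)) ->
    (forall v, V v -> exists c : 'rV[k]_N, v = \sum_i c 0 i *: s i) ->
  exists m, is_quot_dim V W m.
Proof.
move=> Vs spans.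
pose gen m := exists e : 'I_m -> E, (forall i, V (e i)) /\
  (forall v, V v -> exists c : 'rV[k]_m, W (v - \sum_i c 0 i *: e i)).
have exg : exists m, `[< gen m >].
  exists N; apply/asboolP; exists s; split=> // v /spans[c ->].
  by exists c; rewrite subrr.
case: (ex_minnP exg) => m /asboolP[e [Ve spane]] minm.
exists m, e; split=> // v Vv; have [c Wc] := spane v Vv.
exists c; split=> // c' Wc'; apply/rowP => j; apply/eqP/negP => /negP neq.
case: m e Ve spane minm c Wc c' Wc' j neq => [|m] e Ve spane minm c Wc c' Wc' j.
  by case: j.
move=> neq.
pose b := c - c'.
have bj : b 0 j != 0 by rewrite !mxE subr_eq0.
have Wb : W (\sum_i b 0 i *: e i).
  have := WB Wc' Wc; rewrite opprB addrC addrA subrK -sumrB; congr W.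
  by apply: eq_bigr => i _; rewrite -scalerBl !mxE.
suff /asboolP/minm : gen m by rewrite ltnn.
exists (fun i => e (lift j i)); split=> // u Vu; have [a Wa] := spane u Vu.
pose t := a 0 j / b 0 j.
exists (\row_i (a 0 (lift j i) - t * b 0 (lift j i))).
suff -> : \sum_i (\row_i (a 0 (lift j i) - t * b 0 (lift j i))) 0 i
              *: e (lift j i)
        = \sum_i a 0 i *: e i - t *: (\sum_i b 0 i *: e i).
  by rewrite opprB addrCA; apply: WP.
rewrite scaler_sumr -sumrB [RHS](bigD1_ord j) //= scalerA /t divfK // subrr.
by rewrite add0r; apply: eq_bigr => i _; rewrite mxE scalerBl scalerA.
Qed.

Lemma is_quot_dim_uniq (m p : nat) :
  is_quot_dim V W m -> is_quot_dim V W p -> m = p.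
Proof.
suff le m' p' : is_quot_dim V W m' -> is_quot_dim V W p' -> (m' <= p')%N.
  by move=> dm dp; apply/eqP; rewrite eqn_leq !le.
case=> e [Ve base] [e' [Ve' base']].
have exM i : exists c : 'rV[k]_p', W (e i - \sum_j c 0 j *: e' j).
  by have [c []] := base' _ (Ve i); exists c.
pose M := \matrix_i projT1 (cid (exM i)).
have WM i : W (e i - \sum_j M i j *: e' j).
  have := projT2 (cid (exM i)); congr (W (_ - _)).
  by apply: eq_bigr => j _; rewrite mxE.
have WS (I : finType) (F : I -> E) : (forall i, W (F i)) -> W (\sum_i F i).
  move=> WF; apply: (big_ind W) => // x y Wx Wy.
  by rewrite -[x]scale1r; apply: WP.
suff /eqP <- : row_free M by apply: rank_leq_col.
apply: inj_row_free => c cM.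
have Wc : W (\sum_i c 0 i *: e i).
  have := WS _ _ (fun i => WZ (c 0 i) (WM i)).
  under eq_bigr do rewrite scalerBr scaler_sumr.
  rewrite sumrB exchange_big /= [X in _ - X]big1 ?subr0 // => j _.
  under eq_bigr do rewrite scalerA.
  by rewrite -scaler_suml; move/rowP/(_ j): cM; rewrite !mxE => ->; rewrite scale0r.
case: m' e Ve base exM M WM c cM Wc => [|m'] e Ve base _ _ _ c _ Wc.
  by apply/rowP; case.
have [a [Wa uniqa]] := base _ (Ve ord0).
have /uniqa/eqP : W (e ord0 - \sum_i (a + c) 0 i *: e i).
  under eq_bigr do rewrite mxE scalerDl.
  by rewrite big_split /= opprD addrA; apply: WB.
by rewrite -[X in X == _]addr0 (inj_eq (addrI a)) eq_sym => /eqP.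
Qed.

End QuotDim.

Section Codimension.
Variables (k : fieldType) (A : assocAlgebra k) (n : nat).
Local Open Scope classical_set_scope.

Definition Id : set (freeAlg k) := [set f | is_identity A f].

Definition mlmonom (s : 'S_n) : freeAlg k := \prod_(i < n) fvar k (s i).

Definition mlpoly : set (freeAlg k) :=
  [set f | exists c : 'S_n -> k, f = \sum_s c s *: mlmonom s].

Lemma feval_supp (a : nat -> A) (f : freeAlg k) (D : {fset {fmonom nat}}) :
  (msupp f `<=` D)%fset -> feval a f = \sum_(w <- D) f@_w *: weval a w.
Proof.
move=> sfD; rewrite /feval; apply: big_fset_incl => // w _.
by move/mcoeff_outdom => ->; rewrite scale0r.
Qed.

Lemma fevalP (a : nat -> A) (c : k) (f g : freeAlg k) :
  feval a (c *: f + g) = c *: feval a f + feval a g.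
Proof.
pose D := (msupp f `|` msupp g `|` msupp (c *: f + g))%fset.
rewrite !(@feval_supp a _ D) ?fsubsetUr //; last 2 first.
- by rewrite /D -fsetUA fsetUCA fsubsetUl.
- by rewrite /D -fsetUA fsubsetUl.
rewrite scaler_sumr -big_split /=; apply: eq_bigr => w _.
by rewrite mcoeffD mcoeffZ scalerDl scalerA.
Qed.

Lemma mlId0 : (mlpoly `&` Id) 0.
Proof.
split; first by exists (fun=> 0); rewrite big1 // => s _; rewrite scale0r.
by split=> [|a]; rewrite ?mcoeff0 // /feval msupp0 big_seq_fset0.
Qed.

Lemma mlIdP (c : k) f g :
  (mlpoly `&` Id) f -> (mlpoly `&` Id) g -> (mlpoly `&` Id) (c *: f + g).
Proof.
move=> [[a ->] [f0 fI]] [[b ->] [g0 gI]]; split; last first.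
  split=> [|x]; first by rewrite mcoeffD mcoeffZ f0 g0 mulr0 addr0.
  by rewrite fevalP fI gI scaler0 addr0.
exists (fun s => c * a s + b s); rewrite scaler_sumr -big_split /=.
by apply: eq_bigr => s _; rewrite scalerDl scalerA.
Qed.

Lemma codim_ex : exists m, is_quot_dim mlpoly (mlpoly `&` Id) m.
Proof.
apply: (is_quot_dim_ex mlId0 mlIdP
  (s := fun i : 'I_#|{: 'S_n}| => mlmonom (enum_val i))).
  move=> i; exists (fun s => (s == enum_val i)%:R).
  rewrite (bigD1 (enum_val i)) //= eqxx scale1r big1 ?addr0 // => s.
  by move/negPf => ->; rewrite scale0r.
move=> v [c ->]; exists (\row_i c (enum_val i)).
rewrite (reindex (@enum_val _ (mem {: 'S_n}))) /=; last first.
  by apply: onW_bij; apply: enum_val_bij.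
by apply: eq_bigr => i _; rewrite mxE.
Qed.

(* c_n(A) = dim_k P_n / (P_n :&: Id(A)). *)
Definition codim : nat := projT1 (cid codim_ex).

Lemma codimE m : is_quot_dim mlpoly (mlpoly `&` Id) m <-> codim = m.
Proof.
have dc := projT2 (cid codim_ex); split=> [|<- //].
exact: (is_quot_dim_uniq mlId0 mlIdP dc).
Qed.

End Codimension.

Section WordLength.
Variable n : nat.
Local Open Scope group_scope.

Definition adj_tperms : {set 'S_n} :=
  [set s | [exists i : 'I_n, exists j : 'I_n,
     (val j == (val i).+1) && (s == tperm i j)]].

(* [s] is a product of [l] adjacent transpositions; inverses are not needed as
   the generators are involutions. *)
Definition is_adj_word (s : 'S_n) (l : nat) : bool :=
  [exists c : {ffun 'I_l -> 'S_n},
    [forall i, c i \in adj_tperms] && (s == \prod_i c i)].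

Lemma tperm_adj_gen (i j : 'I_n) : tperm i j \in <<adj_tperms>>.
Proof.
wlog lij : i j / (i <= j)%N.
  by move=> H; case/orP: (leq_total i j) => /H //; rewrite tpermC.
move: {2}(j - i)%N (erefl (j - i)%N) => l; elim: l i j lij => [|l IH] i j lij dl.
  have -> : i = j by apply/val_inj/eqP; rewrite eqn_leq lij -subn_eq0 dl.
  by rewrite tperm1 group1.
have ltij : (i < j)%N by rewrite -subn_gt0 dl.
have ltj' : (j.-1 < n)%N by apply: leq_ltn_trans (leq_pred _) (ltn_ord j).
pose j' := Ordinal ltj'.
have jE : j = j'.+1 :> nat by rewrite /= (ltn_predK ltij).
have adj : tperm j' j \in <<adj_tperms>>.
  apply: mem_gen; rewrite inE; apply/existsP; exists j'; apply/existsP; exists j.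
  by rewrite eqxx andbT; apply/eqP.
case: l IH dl => [|l] IH dl.
  suff -> : i = j' by [].
  by apply/val_inj => /=; move: (subnK lij); rewrite dl add1n => <-.
have lij' : (i <= j')%N by rewrite -ltnS -jE.
have dl' : (j' - i = l.+1)%N by move: dl; rewrite jE subSn // => -[].
suff -> : tperm i j = tperm i j' ^ tperm j' j by apply: groupJ => //; apply: IH.
have nji : j != i by apply: contraTneq ltij => ->; rewrite ltnn.
have nj'i : j' != i by apply/eqP => E; move: dl'; rewrite E subnn.
by rewrite tpermJ tpermL tpermD.
Qed.

Lemma adj_word_ex (s : 'S_n) : exists l, is_adj_word s l.
Proof.
have : s \in <<adj_tperms>>.
  have [ts -> _] := prod_tpermP s.
  by apply: group_prod => t _; apply: tperm_adj_gen.
case/gen_prodgP => l [c cA ->]; exists l; apply/existsP; exists (finfun c).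
apply/andP; split; first by apply/forallP => i; rewrite ffunE.
by apply/eqP/eq_bigr => i _; rewrite ffunE.
Qed.

Definition wlen (s : 'S_n) : nat := ex_minn (adj_word_ex s).

(* \hat B(K) *)
Definition Bhat (K : rat) : {set 'S_n} := [set s | (K <= (wlen s)%:R)%R].

End WordLength.

(* K_n, for an identity of degree d *)
Definition Kbound (d n : nat) : rat := (n%:R - d%:R) / 2.

(* Main.v *)
Require Import Defs.
From HB Require Import structures.
From mathcomp Require Import all_boot all_order all_algebra all_fingroup.
From mathcomp Require Import zify.
From mathcomp Require Import finmap monalg.
From mathcomp Require Import boolp.

Set Implicit Arguments.
Unset Strict Implicit.
Unset Printing Implicit Defensive.

Import Order.TTheory GRing.Theory Num.Theory.
Local Open Scope ring_scope.

(** The theorem compares the codimension with the number of long permutations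
    by combining two facts about permutations whose word has no increasing
    subword of length [d].

    They are long.  An adjacent transposition preserves the order of every
    pair of values except one, so a product of [l] of them is increasing on at
    least [n - l] positions ([wlen_increasing]).  Hence if [|s| < (n - d) / 2]
    then, as [d <= n], the word of [s] contains an increasing subword of
    length [n - |s| >= d].

    They span the multilinear polynomials modulo identities (Latyshev's
    argument).  From a polynomial identity of degree [d] one extracts a
    multilinear one of the same degree,
      [sum_s c s * x_(s 0) ... x_(s (d-1))] with [c 1 = 1]
    ([PI_multilinear]).  If a word contains letters [v_0 < ... < v_(d-1)] in
    this order, cut it as [w0 b_0 ... b_(d-1)], where the block [b_j] starts
    with [v_j], and substitute [b_j] for [x_j].  Modulo identities this
    expresses the word through the words in which the blocks are permuted
    nontrivially ([blocks_rewrite]); as the heads of the blocks increase, all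
    of these are lexicographically larger ([ltxi_permblocks]).  Since there
    are finitely many words, the rewriting ends in the span of the words
    without such a subword ([spanned_of_increasing]), and the dimension of the
    quotient is at most their number ([codim_le_card_spanning]).

    The multilinear identity is obtained over any field, without dividing by
    factorials, by polarizing one monomial [w] of maximal degree [d]: introduce
    one new variable per position of [w], replace each variable of the identity
    by the sum of the new variables at the positions where it occurs in [w],
    and keep, by inclusion-exclusion, the words that use every new variable.  A
    word of length at most [d] that uses all [d] variables is a permutation of
    them, so this is the noncommutative form of Ryser's permanent formula
    ([Ryser_sum], [full_polarization]). *)

(** * Adjoining a unit *)

(** The Dorroh extension.  Its purpose is to make ring products, and so
    iterated products and their distributivity, available for algebras without
    a unit; the empty word then also has a value. *)
Definition unitization (k : fieldType) (A : assocAlgebra k) : Type :=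
  (k^o * A)%type.

Section Unitization.
Variables (k : fieldType) (A : assocAlgebra k).
Local Notation U := (unitization A).

HB.instance Definition _ := GRing.Lmodule.on U.

Definition uone : U := (1, 0).
Definition umul (x y : U) : U :=
  (x.1 * y.1, x.1 *: y.2 + y.1 *: x.2 + amul x.2 y.2).

Lemma amul0l (x : A) : amul 0 x = 0.
Proof. by rewrite -(scale0r x) amulZl !scale0r. Qed.

Lemma amul0r (x : A) : amul x 0 = 0.
Proof. by rewrite -(scale0r x) amulZr !scale0r. Qed.

Lemma umulA : associative umul.
Proof.
move=> [a x] [b y] [c z]; congr pair; rewrite /= ?mulrA //.
rewrite !(amulDl, amulDr, amulZl, amulZr, scalerDr, scalerA) amulA.
rewrite [(c * a)]mulrC [c * b]mulrC -!addrA; do 2!congr (_ + _).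
by rewrite addrCA; congr (_ + _); rewrite [RHS]addrCA;
  congr (_ + _); apply: addrCA.
Qed.

Lemma umul1l : left_id uone umul.
Proof.
by case=> a x; rewrite /umul /= mul1r scale1r scaler0 amul0l !addr0.
Qed.

Lemma umul1r : right_id uone umul.
Proof.
by case=> a x; rewrite /umul /= mulr1 scale1r scaler0 amul0r add0r addr0.
Qed.

Lemma umulDl : left_distributive umul +%R.
Proof.
move=> [a x] [b y] [c z]; congr pair; rewrite /= ?mulrDl //.
by rewrite amulDl scalerDl scalerDr [RHS]addrACA; congr (_ + _); apply: addrACA.
Qed.

Lemma umulDr : right_distributive umul +%R.
Proof.
move=> [a x] [b y] [c z]; congr pair; rewrite /= ?mulrDr //.
by rewrite amulDr scalerDl scalerDr [RHS]addrACA; congr (_ + _); apply: addrACA.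
Qed.

Lemma uone_neq0 : uone != 0.
Proof. by apply/eqP => -[] /eqP; rewrite oner_eq0. Qed.

HB.instance Definition _ := GRing.Zmodule_isNzRing.Build U
  umulA umul1l umul1r umulDl umulDr uone_neq0.

Lemma uscaleAl (c : k) (x y : U) : c *: (x * y) = (c *: x) * y.
Proof.
case: x y => [a x] [b y]; congr pair; rewrite /=; first exact: (@mulrA k).
by rewrite !scalerDr !scalerA amulZl [b * c]mulrC.
Qed.

HB.instance Definition _ := GRing.Lmodule_isLalgebra.Build k U uscaleAl.

Lemma uscaleAr (c : k) (x y : U) : c *: (x * y) = x * (c *: y).
Proof.
case: x y => [a x] [b y]; congr pair; rewrite /=; first exact: (@mulrCA k).
by rewrite !scalerDr !scalerA amulZr [c * a]mulrC.
Qed.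

HB.instance Definition _ := GRing.Lalgebra_isAlgebra.Build k U uscaleAr.

Definition inA (x : A) : U := (0, x).

Lemma inA_is_linear : linear inA.
Proof. by move=> c x y; congr pair; rewrite /= [_ *: 0]mulr0 addr0. Qed.

HB.instance Definition _ := GRing.isLinear.Build k A U _ inA inA_is_linear.

Lemma inA_inj : injective inA.
Proof. by move=> x y []. Qed.

Lemma inAM x y : inA (amul x y) = inA x * inA y.
Proof. by congr pair; rewrite /= ?mul0r // !scale0r !add0r. Qed.

Lemma inA_weval (a : nat -> A) (w : seq nat) : w != [::] ->
  inA (weval a w) = \prod_(i <- w) inA (a i).
Proof.
case: w => // i w _; rewrite big_cons /=.
elim: w (a i) => [|j w IH] x; first by rewrite big_nil mulr1.
by rewrite big_cons mulrA -inAM /= IH.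
Qed.

End Unitization.

(** * Ryser's formula in a noncommutative algebra *)

Section Ryser.
Variable k : comNzRingType.

(** Inclusion-exclusion: this is the expansion of the product over [j] of
    [1 - (j \notin S)], one factor of which vanishes unless [S] is full. *)
Lemma sum_sign_superset (I : finType) (S : {set I}) :
  \sum_(T : {set I}) (-1) ^+ #|~: T| * (S \subset T)%:R = (S == setT)%:R :> k.
Proof.
have -> : (S == setT)%:R = \prod_j (1 - (j \notin S)%:R) :> k.
  case: (boolP (S == setT)) => [/eqP->|nT].
    by rewrite big1 // => j _; rewrite in_setT subr0.
  have /subsetPn[j _ jS] : ~~ ([set: I] \subset S) by rewrite subTset.
  by rewrite (bigD1 j) //= jS subrr mul0r.
rewrite bigA_distr; apply: eq_bigr => T _.
case: (boolP (S \subset T)) => [/subsetP ST|/subsetPn[j jS jT]]; last first.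
  by rewrite mulr0 (bigD1 j) //= (negPf jT) jS oppr0 mul0r.
rewrite mulr1 -prodr_const [RHS]big_mkcond /=.
rewrite big_mkcond; apply: eq_bigr => j _; rewrite in_setC.
by case: (boolP (j \in T)) => //= jT; rewrite (contraNN (ST j) jT).
Qed.

(** Expanding the product over all maps [g] from the [m] positions to ['I_d],
    the signed sum over [T] keeps the surjective ones.  There is none for
    [m < d], and for [m = d] they are the permutations. *)
Lemma Ryser_sum (R : algType k) (d m : nat) (F : nat -> 'I_d -> R) :
  (m <= d)%N ->
  \sum_(T : {set 'I_d}) (-1) ^+ #|~: T| *: \prod_(p < m) \sum_(j in T) F p j
    = if m == d then \sum_(s : 'S_d) \prod_(p < d) F p (s p) else 0.
Proof.
move=> le_md.
transitivity (\sum_(g : {ffun 'I_m -> 'I_d} | g @: setT == setT)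
    \prod_(p < m) F p (g p)).
  under eq_bigr do rewrite bigA_distr_big scaler_sumr big_mkcond /=.
  rewrite exchange_big [RHS]big_mkcond /=; apply: eq_bigr => g _.
  set P := \prod_(p < m) _; transitivity ((g @: setT == setT)%:R *: P).
    rewrite -sum_sign_superset scaler_suml; apply: eq_bigr => T _.
    suff -> : (g \in ffun_on (mem T)) = (g @: setT \subset T).
      by case: ifP; rewrite ?mulr1 // mulr0 scale0r.
    apply/ffun_onP/subsetP => [gT j /imsetP[p _ ->]|gT p]; first exact: gT.
    by apply/gT/imset_f.
  by case: ifP; rewrite ?scale1r ?scale0r.
case: eqP => [-> {m le_md}|/eqP ne_md]; last first.
  rewrite big1 // => g /eqP gT.
  have := leq_imset_card g setT; rewrite gT !cardsT !card_ord.
  by rewrite leqNgt ltn_neqAle ne_md le_md.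
have surj_inj (g : {ffun 'I_d -> 'I_d}) : (g @: setT == setT) = injectiveb g.
  rewrite eqEcard subsetT /= !cardsT.
  apply/idP/injectiveP => [le_d|ginj]; last by rewrite card_imset ?cardsT.
  suff ginj : {in [set: 'I_d] &, injective g}.
    by move=> i j; apply: ginj; rewrite in_setT.
  by apply/imset_injP; rewrite eqn_leq leq_imset_card cardsT.
(* The permutations are, by their encoding, the injective maps. *)
rewrite (reindex_onto (fun s : 'S_d => pval s)
    (fun g => insubd (1%g : 'S_d) g)) /= => [|g /[!surj_inj] ginj]; last first.
  exact: (insubdK (1%g : 'S_d) ginj).
apply: eq_big => [s|s _]; last by apply: eq_bigr => p _; rewrite pvalE.
by rewrite surj_inj valKd eqxx andbT; exact: (valP s).
Qed.

End Ryser.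

(** * From an identity to a multilinear identity of the same degree *)

Section Multilinearization.
Variable k : fieldType.

Lemma bigmax_seq_attained (I : eqType) (r : seq I) (F : I -> nat) :
  r != [::] -> exists2 i, i \in r & F i = \max_(j <- r) F j.
Proof.
elim: r => // i [|j r] IH _.
  by exists i; rewrite ?mem_head // big_seq1.
case: IH => // i' i'r eF; rewrite big_cons.
case: leqP => _; first by exists i'; first exact: mem_behead.
by exists i; first exact: mem_head.
Qed.

(** The word obtained from [w], assumed of length [d], by permuting its
    positions; among all words with the letters of [w], it is the one that
    produces the monomial [s] of the polarization along [w]. *)
Definition permw (d : nat) (w : seq nat) (s : 'S_d) : {fmonom nat} :=
  FMonom [seq nth 0%N w (s p) | p <- enum 'I_d].

Lemma size_permw d w (s : 'S_d) : size (permw w s) = d.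
Proof. by rewrite size_map size_enum_ord. Qed.

Lemma nth_permw d w (s : 'S_d) (p : 'I_d) :
  nth 0%N (permw w s) p = nth 0%N w (s p).
Proof. by rewrite (nth_map p) ?size_enum_ord // nth_ord_enum. Qed.

Lemma permw_eqP d w (s : 'S_d) (u : {fmonom nat}) : size u = d ->
  (u == permw w s) = [forall p : 'I_d, nth 0%N w (s p) == nth 0%N u p].
Proof.
move=> su; apply/eqP/forallP => [-> p|eq_u]; first by rewrite nth_permw.
apply: val_inj; apply: (@eq_from_nth _ 0%N) => [|i].
  by rewrite su; apply/esym/size_permw.
rewrite su => ltid; have /eqP <- := eq_u (Ordinal ltid).
by rewrite -nth_permw.
Qed.

Lemma permw1 d (w : {fmonom nat}) : size w = d -> permw w (1%g : 'S_d) = w.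
Proof.
move=> sw; apply/esym/eqP; rewrite permw_eqP //.
by apply/forallP => p; rewrite perm1.
Qed.

Lemma prod_nat_of_bool (I : finType) (P : pred I) :
  \prod_i (P i)%:R = [forall i, P i]%:R :> k.
Proof.
case: forallP => [allP|/forallP/forallPn[i nPi]].
  by rewrite big1 // => i _; rewrite allP.
by rewrite (bigD1 i) //= (negPf nPi) mul0r.
Qed.

(** The variable number [i] is replaced by the sum of the [x j] over the
    positions [j] of [T] where [w] has the letter [i].  A word [u] of [f] then
    contributes the monomials [x (s 0) ... x (s (d-1))] such that
    [u = permw w s]; for each [s] there is exactly one such [u], so distinct
    words of [f] do not interfere and no multiplicity arises. *)
Lemma full_polarization (R : algType k) (d : nat) (f : freeAlg k) (w : seq nat)
    (x : 'I_d -> R) : (forall u, u \in msupp f -> size u <= d)%N ->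
  \sum_(T : {set 'I_d}) (-1) ^+ #|~: T| *:
    (\sum_(u <- msupp f)
       f@_u *: \prod_(i <- u) \sum_(j in T | nth 0%N w j == i) x j)
    = \sum_(s : 'S_d) f@_(permw w s) *: \prod_(p < d) x (s p).
Proof.
move=> le_d; under eq_bigr do rewrite scaler_sumr.
rewrite exchange_big /=.
transitivity (\sum_(s : 'S_d) \sum_(u <- msupp f)
    f@_u *: ((u == permw w s)%:R *: \prod_(p < d) x (s p))); last first.
  apply: eq_bigr => s _; under [LHS]eq_bigr do rewrite scalerA.
  rewrite -scaler_suml; congr (_ *: _).
  case: (boolP (permw w s \in msupp f)) => [sf|sf]; last first.
    rewrite mcoeff_outdom // big1_seq // => u /andP[_ uf].
    case: eqP => [e|]; last by rewrite mulr0.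
    by rewrite -e uf in sf.
  rewrite (bigD1_seq _ sf) ?fset_uniq //= eqxx mulr1 big1 ?addr0 // => u.
  by move/negPf=> ->; rewrite mulr0.
rewrite [RHS]exchange_big /=; apply: eq_big_seq => u uf.
under [LHS]eq_bigr do rewrite scalerA mulrC -scalerA.
rewrite -!scaler_sumr; congr (_ *: _).
pose F p (j : 'I_d) : R := (nth 0%N w j == nth 0%N u p)%:R *: x j.
transitivity (\sum_(T : {set 'I_d})
    (-1) ^+ #|~: T| *: \prod_(p < size u) \sum_(j in T) F p j).
  apply: eq_bigr => T _; congr (_ *: _); rewrite (big_nth 0%N) big_mkord.
  apply: eq_bigr => p _; rewrite big_mkcondr; apply: eq_bigr => j _.
  by rewrite /F; case: ifP; rewrite ?scale1r ?scale0r.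
rewrite Ryser_sum ?le_d //; case: eqP => [su|su]; last first.
  rewrite big1 // => s _; case: eqP => [e|]; last by rewrite scale0r.
  by case: su; rewrite e size_permw.
apply: eq_bigr => s _; rewrite scaler_prod prod_nat_of_bool.
by rewrite -permw_eqP.
Qed.

(** The coefficient of the identity permutation in the polarization along
    [w] is that of [w] in [f], which is nonzero and may be normalized to 1. *)
Lemma PI_multilinear (A : assocAlgebra k) (d : nat) :
  satisfies_PI_of_degree A d ->
  (0 < d)%N /\ exists2 c : 'S_d -> k, c 1%g = 1 &
    forall b : 'I_d -> A, \sum_s c s *: \prod_(p < d) inA (b (s p)) = 0.
Proof.
case=> f [f_neq0 [f0 fI] fd].
have [w wf sw] : exists2 w : {fmonom nat}, w \in msupp f & size w = d.
  rewrite -fd; apply: (bigmax_seq_attained (@fdeg nat)).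
  apply: contraNneq f_neq0 => f_nil; rewrite -msupp_eq0.
  apply/eqP/fsetP => u; rewrite in_fset0; apply/negP => uf.
  by have : u \in enum_fset (msupp f) := uf; rewrite f_nil.
have nz u : u \in msupp f -> fmonom_val u != [::].
  rewrite -mcoeff_neq0; apply: contraNneq => u0.
  by rewrite -f0; apply/eqP; congr (f@_ _); apply: val_inj; rewrite /= u0 fm1.
split; first by rewrite -sw lt0n size_eq0 nz.
exists (fun s => (f@_w)^-1 * f@_(permw w s)).
  by rewrite permw1 // mulVf // mcoeff_neq0.
move=> b; under eq_bigr do rewrite -scalerA.
rewrite -scaler_sumr -(full_polarization _ (fun j => inA (b j))) => [|u uf].
  (* Each term of the polarization is a value of the identity [f] in [A]. *)
  rewrite big1 ?scaler0 // => T _.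
  pose bT (i : nat) := \sum_(j in T | nth 0%N w j == i) b j.
  transitivity ((-1) ^+ #|~: T| *: inA (feval bT f)); last first.
    by rewrite fI (raddf0 (@inA k A)) scaler0.
  congr (_ *: _); rewrite raddf_sum; apply: eq_big_seq => u uf.
  rewrite [RHS]linearZ /= inA_weval ?nz //.
  by congr (_ *: _); apply: eq_bigr => i _; rewrite raddf_sum.
by rewrite -fd; apply: (leq_bigmax_seq (F := @fdeg nat)).
Qed.

End Multilinearization.

(** * Short permutations have long increasing subwords *)

Section IncreasingSubword.

Lemma index_enumE (T : finType) : index_enum T = enum T.
Proof. by rewrite enumT [index_enum T]unlock. Qed.

Definition permword (n : nat) (s : 'S_n) : seq nat :=
  [seq val (s i) | i <- enum 'I_n].

(** Only the pair [{v, v + 1}] is reversed, so it suffices to exclude [v]. *)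
Lemma adj_tperm_homo (n : nat) (v v' a b : 'I_n) : v' = v.+1 :> nat ->
  a != v -> b != v -> (a < b)%N -> (tperm v v' a < tperm v v' b)%N.
Proof.
move=> v'E av bv ltab; have := av; rewrite -val_eqE /= => nav.
case: (tpermP v v' b) => [bE|bE|nb nb'];
  case: (tpermP v v' a) => [aE|aE|na na'].
all: rewrite ?bE ?aE ?eqxx in av bv ltab nav *; lia.
Qed.

(** Each factor costs at most one position: the one which the product of the
    preceding factors sends to the smaller of the two values exchanged. *)
Lemma adj_word_increasing (n : nat) (ts : seq 'S_n) :
  {subset ts <= adj_tperms n} ->
  exists2 S : {set 'I_n}, (n <= #|S| + size ts)%N &
    {in S &, {homo (\prod_(t <- ts) t)%g : i j / (i < j)%N}}.
Proof.
elim/last_ind: ts => [|ts t IH] adj.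
  exists setT; first by rewrite cardsT card_ord leq_addr.
  by move=> i j _ _ ltij; rewrite big_nil !perm1.
have [|S leS incS] := IH.
  by move=> u us; apply: adj; rewrite mem_rcons inE us orbT.
have : t \in adj_tperms n by apply: adj; rewrite mem_rcons mem_head.
rewrite inE => /existsP[v /existsP[v' /andP[/eqP v'E /eqP tE]]].
rewrite -cats1; set p := (\prod_(t <- ts) t)%g in incS.
exists (S :\ (p^-1)%g v).
  rewrite size_cat addn1 addnS -addSn; apply: leq_trans leS _.
  by rewrite leq_add2r (cardsD1 ((p^-1)%g v)) -add1n leq_add2r leq_b1.
move=> i j /setD1P[iv iS] /setD1P[jv jS] ltij.
rewrite big_cat big_seq1 /= -/p !permM tE; apply: adj_tperm_homo => //.
- by apply: contraNneq iv => <-; rewrite permK.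
- by apply: contraNneq jv => <-; rewrite permK.
- exact: incS.
Qed.

Lemma wlen_increasing (n : nat) (s : 'S_n) :
  exists v, [/\ subseq v (permword s), sorted ltn v & (n <= size v + wlen s)%N].
Proof.
rewrite /wlen; case: ex_minnP => l /existsP[c /andP[/forallP cA /eqP sE]] _.
have [|S leS incS] := @adj_word_increasing n [seq c i | i <- enum 'I_l].
  by move=> t /mapP[i _ ->].
rewrite size_map size_enum_ord in leS.
have sE' : s = (\prod_(t <- [seq c i | i <- enum 'I_l]) t)%g.
  by rewrite sE big_map index_enumE.
rewrite -sE' in incS.
exists [seq val (s i) | i <- enum S]; split; last by rewrite size_map -cardE.
  by apply: map_subseq; rewrite enumT; apply: filter_subseq.
rewrite sorted_map; apply: (sub_in_sorted (P := mem S) (e := relpre val ltn)).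
- by move=> i j iS jS; apply: incS.
- by apply/allP => i; rewrite mem_enum.
apply: sorted_filter; first by move=> i j k; apply: ltn_trans.
by rewrite -enumT -sorted_map val_enum_ord iota_ltn_sorted.
Qed.

End IncreasingSubword.

(** * Cutting words into blocks with increasing heads *)

Section Blocks.

(** Cut [w] in front of each letter of an occurrence of [v]. *)
Lemma subseq_blocks (T : eqType) (v w : seq T) : subseq v w ->
  exists w0 bs, w = w0 ++ flatten bs /\ map ohead bs = map Some v.
Proof.
elim: w v => [|x w IH] [|y v] //=.
- by exists [::], [::].
- by exists (x :: w), [::]; rewrite cats0.
case: eqP => [->|_] /IH[w0 [bs [-> hd]]].
  by exists [::], ((x :: w0) :: bs); rewrite /= hd.
by exists (x :: w0), bs.
Qed.

Lemma ltxi_cat2l (w u v : seq nat) :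
  ((w ++ u : seqlexi nat) < w ++ v)%O = ((u : seqlexi nat) < v)%O.
Proof. by elim: w => //= x w IH; rewrite eqhead_ltxiE. Qed.

Definition permblocks (T : Type) (d : nat) (bs : seq (seq T)) (s : 'S_d) :
    seq (seq T) :=
  [seq nth [::] bs (s p) | p <- enum 'I_d].

(** Everything below the first moved point is fixed, so this point can only
    move up. *)
Lemma perm_first_moved (d : nat) (s : 'S_d) : s != 1%g ->
  exists2 k : 'I_d, (k < s k)%N & forall i : 'I_d, (i < k)%N -> s i = i.
Proof.
move=> s1; have [k0 k0s] : exists k, s k != k.
  apply/existsP; apply: contraR s1; rewrite negb_exists => /forallP fix_s.
  by apply/eqP/permP => i; rewrite perm1; apply/eqP/negbNE/fix_s.
case: (@arg_minnP _ k0 (fun k => s k != k) val k0s) => k ks mink.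
have fix_lt (i : 'I_d) : (i < k)%N -> s i = i.
  by move=> ltik; apply: contraTeq ltik => /mink; rewrite -leqNgt.
exists k => //; rewrite ltn_neqAle eq_sym val_eqE ks leqNgt /=.
by apply: contra ks => /fix_lt/perm_inj ->.
Qed.

(** The two words agree up to the first block [k] moved by [s]; there, the
    block [s k] takes the place of [k], and its head is larger as [k < s k]. *)
Lemma ltxi_permblocks (d : nat) (bs : seq (seq nat)) (v : seq nat) (s : 'S_d) :
    map ohead bs = map Some v -> size v = d -> sorted ltn v -> s != 1%g ->
  ((flatten bs : seqlexi nat) < flatten (permblocks bs s))%O.
Proof.
move=> hd sv inc_v /perm_first_moved[k ltk fix_lt].
have sb : size bs = d by rewrite -sv -(size_map ohead) hd size_map.
have sb' : size (permblocks bs s) = d by rewrite size_map size_enum_ord.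
have nth_b' (i : 'I_d) : nth [::] (permblocks bs s) i = nth [::] bs (s i).
  by rewrite (nth_map i) ?size_enum_ord // nth_ord_enum.
set bs' := permblocks bs s in sb' nth_b' *.
rewrite -(cat_take_drop k bs) -(cat_take_drop k bs') !flatten_cat.
have -> : take k bs' = take k bs.
  apply: (@eq_from_nth _ [::]);
    rewrite !size_take ?sb ?sb' ltn_ord // => i ltik.
  have ltid := ltn_trans ltik (ltn_ord k).
  by rewrite !nth_take // (nth_b' (Ordinal ltid)) fix_lt.
rewrite ltxi_cat2l (@drop_nth _ [::] k bs) ?sb ?ltn_ord //.
rewrite (@drop_nth _ [::] k bs') ?sb' ?ltn_ord // nth_b' .
have hd_nth (i : 'I_d) : ohead (nth [::] bs i) = Some (nth 0%N v i).
  by rewrite -(nth_map _ None) ?sb // hd (nth_map 0%N) ?sv.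
have lt_hd : (nth 0%N v k < nth 0%N v (s k))%N.
  by apply: (sorted_ltn_nth ltn_trans) => //; rewrite inE sv.
move: (hd_nth k) (hd_nth (s k)).
case: (nth [::] bs k) => // x u [->].
case: (nth [::] bs (s k)) => // y u' [->] /=.
by rewrite neqhead_ltxiE ?ltEnat //= neq_ltn lt_hd.
Qed.

Lemma perm_eq_permblocks (T : eqType) (d : nat) (bs : seq (seq T)) (s : 'S_d) :
  size bs = d -> perm_eq (permblocks bs s) bs.
Proof.
move=> sb; rewrite /permblocks (map_comp (nth [::] bs)).
rewrite -[X in perm_eq _ X](mkseq_nth [::]) /mkseq sb -val_enum_ord.
apply: perm_map.
rewrite map_comp; apply/perm_map/uniq_perm; rewrite ?enum_uniq //.
  by rewrite map_inj_uniq ?enum_uniq //; apply: perm_inj.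
by move=> i; rewrite mem_enum -[i](permKV s) mem_map ?mem_enum //;
  apply: perm_inj.
Qed.

Lemma perm_eq_permword (n : nat) (s : 'S_n) (w : seq nat) :
  perm_eq w (permword s) -> exists t : 'S_n, w = permword t.
Proof.
case/(tuple_permP (t := map_tuple (fun i => val (s i)) (ord_tuple n))) => p ->.
exists (p * s)%g; apply: eq_map => i /=.
by rewrite tnth_map tnth_ord_tuple permM.
Qed.

End Blocks.

(** * Latyshev's rewriting *)

Section Spanning.
Variables (k : fieldType) (A : assocAlgebra k).

Lemma prod_inA_neq_nil (a : nat -> A) (w : seq nat) : w != [::] ->
  exists y, \prod_(i <- w) inA (a i) = inA y.
Proof. by move=> w0; exists (weval a w); rewrite inA_weval. Qed.

Section WithIdentity.
Variables (d n : nat) (c : 'S_d -> k).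
Hypotheses (c1 : c 1%g = 1)
  (c_id : forall b : 'I_d -> A, \sum_s c s *: \prod_(p < d) inA (b (s p)) = 0).

(** Substitute the values of the blocks in the multilinear identity, multiply
    by the value of [w0] on the left and solve for the term of the identity
    permutation.  The blocks must be nonempty for their values to lie in [A],
    outside of which the identity need not hold. *)
Lemma blocks_rewrite (a : nat -> A) (w0 : seq nat) (bs : seq (seq nat)) :
    size bs = d -> all (fun b => b != [::]) bs ->
  \prod_(i <- w0 ++ flatten bs) inA (a i)
    = \sum_(s : 'S_d | s != 1%g)
        - c s *: \prod_(i <- w0 ++ flatten (permblocks bs s)) inA (a i).
Proof.
move=> sb bs_neq0.
have /choice[y yE] (p : 'I_d) :
    exists y, \prod_(i <- nth [::] bs p) inA (a i) = inA y.
  by apply/prod_inA_neq_nil/(allP bs_neq0)/mem_nth; rewrite sb.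
have prod_blocks (s : 'S_d) :
    \prod_(i <- flatten (permblocks bs s)) inA (a i)
      = \prod_(p < d) inA (y (s p)).
  rewrite big_flatten big_map -index_enumE.
  by apply: eq_bigr => p _; rewrite yE.
have bs1 : permblocks bs (1%g : 'S_d) = bs.
  rewrite -[RHS](mkseq_nth [::]) /mkseq sb -val_enum_ord -map_comp.
  by apply: eq_map => p /=; rewrite perm1.
rewrite -{1}bs1.
under [RHS]eq_bigr do rewrite big_cat prod_blocks scalerAr /=.
rewrite -mulr_sumr big_cat prod_blocks; congr (_ * _).
have := c_id y; rewrite (bigD1 1%g) //= c1 scale1r => /eqP.
rewrite addr_eq0 => /eqP ->; rewrite -sumrN.
by apply: eq_bigr => s _; rewrite scaleNr.
Qed.

(** Spanning modulo the identities of [A], stated on values in order to compute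
    in [A] rather than in a quotient of the free algebra. *)
Definition spanned (B : {set 'S_n}) (w : seq nat) : Prop :=
  exists2 b : 'S_n -> k, (forall t, t \notin B -> b t = 0) &
    forall a : nat -> A,
      \prod_(i <- w) inA (a i)
        = \sum_t b t *: \prod_(i <- permword t) inA (a i).

(** A lexicographically largest word that is not spanned would be rewritten as
    a combination of larger words, which are spanned. *)
Lemma spanned_of_increasing (B : {set 'S_n}) :
    (forall s, s \notin B -> exists v,
       [/\ subseq v (permword s), sorted ltn v & size v = d]) ->
  forall s : 'S_n, spanned B (permword s).
Proof.
move=> incB s0; apply: contrapT => nspan0.
pose bad (s : 'S_n) := ~~ `[< spanned B (permword s) >].
have bad0 : bad s0 by apply/asboolPn.
case: (@arg_maxP _ _ _ s0 bad (fun s => permword s : seqlexi nat) bad0).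
move=> s /asboolPn nspan maxs; apply: nspan.
case: (boolP (s \in B)) => [sB|/incB[v [v_sub inc_v sv]]].
  exists (fun t => (t == s)%:R) => [t|a].
    by case: eqP => // ->; rewrite sB.
  rewrite [RHS](bigD1 s) //= eqxx scale1r.
  rewrite [X in _ + X]big1 ?addr0 // => t /negPf ->.
  by rewrite scale0r.
have [w0 [bs [wE hd]]] := subseq_blocks v_sub.
have sb : size bs = d by rewrite -sv -(size_map ohead) hd size_map.
have bs_neq0 : all (fun b => b != [::]) bs.
  apply/allP => b b_bs; have := map_f ohead b_bs; rewrite hd.
  by case: b b_bs => // _ /mapP[].
have /choice[b bP] (p : 'S_d) : exists b : 'S_n -> k, p != 1%g ->
    (forall t, t \notin B -> b t = 0) /\ forall a : nat -> A,
    \prod_(i <- w0 ++ flatten (permblocks bs p)) inA (a i)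
      = \sum_t b t *: \prod_(i <- permword t) inA (a i).
  case: (eqVneq p 1%g) => [_|p1]; first by exists (fun=> 0).
  have [t tE] : exists t : 'S_n, w0 ++ flatten (permblocks bs p) = permword t.
    by apply: (@perm_eq_permword _ s); rewrite wE perm_cat2l perm_flatten //
      perm_eq_permblocks.
  have lt_st : ((permword s : seqlexi nat) < permword t)%O.
    by rewrite -tE wE ltxi_cat2l (ltxi_permblocks hd).
  have [bt bt0 btE] : spanned B (permword t).
    apply/asboolP; apply: contraTT lt_st => badt.
    by rewrite -leNgt; apply: maxs.
  by exists bt; rewrite tE.
exists (fun t => \sum_(p | p != 1%g) - c p * b p t) => [t tB|a].
  by rewrite big1 // => p /bP[-> //]; rewrite mulr0.
rewrite wE (blocks_rewrite _ _ sb bs_neq0).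
under [RHS]eq_bigr do rewrite scaler_suml.
rewrite exchange_big /=; apply: eq_bigr => p /bP[_ ->].
by rewrite scaler_sumr; apply: eq_bigr => t _; rewrite scalerA.
Qed.

End WithIdentity.
End Spanning.

(** * The bound on the codimension *)

Section CodimBound.
Variables (k : fieldType) (A : assocAlgebra k) (n : nat).

Lemma mlmonomE (s : 'S_n) : mlmonom k s = << FMonom (permword s) >>.
Proof.
rewrite /mlmonom /permword index_enumE.
elim: (enum _) => [|i r IH]; first by rewrite big_nil -fmoneE.
rewrite big_cons IH malgM_def /fvar fgmulUU mulr1 fmuE; congr << _ >>.
exact: fmmulE.
Qed.

Lemma feval_mlmonom (a : nat -> A) (s : 'S_n) :
  feval a (mlmonom k s) = weval a (permword s).
Proof.
by rewrite mlmonomE /feval msuppU1 big_seq_fset1 mcoeffU1 eqxx scale1r.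
Qed.

Lemma feval_sum (a : nat -> A) (I : Type) (r : seq I) (c : I -> k)
    (g : I -> freeAlg k) :
  feval a (\sum_(i <- r) c i *: g i) = \sum_(i <- r) c i *: feval a (g i).
Proof.
elim: r => [|i r IH]; last by rewrite !big_cons fevalP IH.
by rewrite !big_nil /feval msupp0 big_seq_fset0.
Qed.

Lemma mcoeff1_mlmonom (s : 'S_n) :
  (0 < n)%N -> (mlmonom k s)@_(@mone {fmonom nat}) = 0.
Proof.
move=> n_gt0; rewrite mlmonomE mcoeffU1; case: eqP => // e.
have := congr1 (size \o @fmonom_val nat) e.
rewrite /= fm1 size_map size_enum_ord => n0.
by rewrite n0 in n_gt0.
Qed.

(** Write a basis of the quotient through the monomials of [B].  A linear
    relation between the rows of the resulting matrix gives a relation between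
    the basis vectors modulo identities, so it is trivial and the rows are
    free. *)
Lemma codim_le_card_spanning (B : {set 'S_n}) : (0 < n)%N ->
  (forall s : 'S_n, spanned A B (permword s)) -> (codim A n <= #|B|)%N.
Proof.
move=> n_gt0 spanB.
have [e [Ve base]] := (codimE A n _).2 (erefl (codim A n)).
have /choice[c cE] := Ve.
have /choice[b bP] (s : 'S_n) : exists b : 'S_n -> k,
    (forall t, t \notin B -> b t = 0) /\ forall a : nat -> A,
    \prod_(i <- permword s) inA (a i)
      = \sum_t b t *: \prod_(i <- permword t) inA (a i).
  by have [b b0 bE] := spanB s; exists b.
have word_neq0 (s : 'S_n) : permword s != [::].
  by rewrite -size_eq0 size_map size_enum_ord -lt0n.
have inA_ml (a : nat -> A) (x : 'S_n -> k) :
    inA (feval a (\sum_s x s *: mlmonom k s))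
      = \sum_s x s *: \prod_(i <- permword s) inA (a i).
  rewrite feval_sum raddf_sum; apply: eq_bigr => s _.
  by rewrite [LHS]linearZ /= feval_mlmonom inA_weval.
pose M := \matrix_(i < codim A n, j < #|B|) \sum_s c i s * b s (enum_val j).
suff /eqP <- : row_free M by apply: rank_leq_col.
apply: inj_row_free => v vM.
pose x s := \sum_i v 0 i * c i s.
have veE : \sum_i v 0 i *: e i = \sum_s x s *: mlmonom k s.
  under eq_bigr do rewrite cE scaler_sumr.
  rewrite exchange_big; apply: eq_bigr => s _; rewrite scaler_suml.
  by apply: eq_bigr => i _; rewrite scalerA.
have ve_id : is_identity A (\sum_i v 0 i *: e i).
  rewrite veE; split=> [|a].
    rewrite raddf_sum big1 // => s _.
    by rewrite /= mcoeffZ mcoeff1_mlmonom ?mulr0.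
  apply: (@inA_inj k A); rewrite inA_ml.
  under eq_bigr do rewrite (bP _).2 scaler_sumr.
  rewrite exchange_big /= big1 ?raddf0 // => t _.
  under eq_bigr do rewrite scalerA.
  rewrite -scaler_suml; case: (boolP (t \in B)) => [tB|tB]; last first.
    by rewrite big1 ?scale0r // => s _; rewrite (bP s).1 ?mulr0.
  move/rowP/(_ (enum_rank_in tB t)): vM; rewrite !mxE => vMt.
  rewrite [X in X *: _](_ : _ = 0) ?scale0r // -[RHS]vMt.
  under [RHS]eq_bigr do rewrite mxE enum_rankK_in // mulr_sumr.
  rewrite exchange_big; apply: eq_bigr => s _; rewrite mulr_suml.
  by apply: eq_bigr => i _; rewrite mulrA.
have [u [_ uniq_u]] := base 0 (mlId0 A n).1.
have -> : v = u.
  apply/esym/uniq_u; rewrite sub0r -scaleN1r -[_ *: _]addr0.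
  apply: mlIdP (mlId0 A n); split=> //.
  by exists x.
apply: uniq_u; rewrite big1 ?subrr; first exact: mlId0.
by move=> i _; rewrite mxE scale0r.
Qed.

End CodimBound.

Theorem theorem3p10 (k : fieldType) (A : assocAlgebra k) (d : nat)
    (hA : satisfies_PI_of_degree A d) (n : nat) (hn : (d <= n)%N) :
  (codim A n <= #|Bhat n (Kbound d n)|)%N.
Proof.
have [d_gt0 [c c1 c_id]] := PI_multilinear hA.
apply: codim_le_card_spanning; first exact: leq_trans d_gt0 hn.
apply: (spanned_of_increasing c1 c_id) => s.
(* Being short means [2 |s| + d < n], hence [|s| + d <= n]. *)
rewrite inE -ltNge ltr_pdivlMr ?ltr0n // ltrBrDr -natrM -natrD ltr_nat => short.
have [v [vs inc_v le_n]] := wlen_increasing s.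
exists (take d v); split; last by rewrite size_takel //; lia.
  exact: subseq_trans (take_subseq _ _) vs.
exact: take_sorted.
Qed.
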